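(* Suppose that every center $c\in C$ already knows $\mathrm{dist}_{w'}(s,c)$ for all nodes $s$, i.e. $d^c_{w'}(s,c)=\mathrm{dist}_{w'}(s,c)$. After running Algorithm E (the modified short-range algorithm described in the context), every node $t$ knows a value $d^t_{w'}(s,t)\ge\mathrm{dist}_{w'}(s,t)$ for all nodes $s$; furthermore, if $|P^*_{w'}(s,t)|\le h$ or $|P^*_{w'}(s,t)|C|\le h$, then $d^t_{w'}(s,t)=\mathrm{dist}_{w'}(s,t)$. Furthermore, Algorithm E runs in $\tilde O(n\sqrt h)$ rounds.
   Context: Model (CONGEST with possibly asymmetric weights). The network is a connected bidirected graph $G$ with $n$ nodes: a directed graph in which the reverse of every edge is also an edge. Nodes are processors with unique IDs in $\{0,\ldots,n-1\}$ and unlimited local computation, and every node knows $n$. Edge weights of $(u,v)$ are initially known only to $u$ and $v$. In each synchronous round every node may send a message of $O(\log n)$ bits along each incident edge (in both directions, regardless of weights), and messages arrive at the end of the round. $\tilde O$ hides factors polylogarithmic in $n$. Algorithms run in parallel are scheduled together in $O(\mathrm{dilation}+\mathrm{congestion}\cdot\log n)$ rounds, where each finishes in dilation rounds alone and at most congestion messages cross each edge in total. Setting. $w,w',b$ are (possibly asymmetric) weight functions on the edges of $G$; $w$ takes non-negative integer values bounded by $\mathrm{poly}(n)$, $b(u,v)\in\{0,1\}$ and $w'(u,v)=2w(u,v)+b(u,v)$. $\mathrm{dist}_{\hat w}(s,t)$ is the length of a shortest directed $st$-path with respect to $\hat w$, and $d^u_{\hat w}(s,t)$ denotes node $u$'s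 knowledge about (estimate of) it. For a node $s$, the reduced weight is $r_s(u,v)=2\,\mathrm{dist}_w(s,u)+w'(u,v)-2\,\mathrm{dist}_w(s,v)$; it is a non-negative integer and $\mathrm{dist}_{w'}(s,t)=2\,\mathrm{dist}_w(s,t)+\mathrm{dist}_{r_s}(s,t)$. $h$ is the hop parameter ($h=\sqrt n$ in the main application) and $\Delta=\sqrt{1/h}$. $C$ is the set of centers, known to all nodes (in the main application a random sample of $\sqrt n\,\mathrm{polylog}(n)$ nodes). $P^*_{w'}(s,t)$ is a shortest $st$-path with respect to $w'$ with the least number of edges among all such paths (remaining ties broken arbitrarily), and $|P|$ is the number of edges of a path $P$. $P^*_{w'}(s,t)|C$ is the subpath of $P^*_{w'}(s,t)$ from its last center to $t$ (the whole path if it contains no center), and $|P^*_{w'}(s,t)|C|$ is its number of edges. Rounded weights. $r'_s(u,v)=\Delta$ if $r_s(u,v)=0$, and $r'_s(u,v)=\Delta\lceil r_s(u,v)/\Delta\rceil$ otherwise. The $s$-augmented graph $G_s$ is $G$ together with an imaginary edge $(s,t)$ of weight $\mathrm{dist}_{r_s}(s,t)$ for every center $t$. Its weight function $r''_s$ is $r'_s$ on original edges and, on an imaginary edge $(s,t)$, equals $\Delta$ if $\mathrm{dist}_{r_s}(s,t)=0$ and $\Delta\lceil\mathrm{dist}_{r_s}(s,t)/\Delta\rceil$ otherwise. Algorithm E (short-range-extension). Input: every node $t$ knows $\mathrm{dist}_w(s,t)$ and $r_s(t,x)$ for all nodes $s$ and all neighbors $x$ of $t$; every center $t$ knows $\mathrm{dist}_{w'}(s,t)$,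 hence $\mathrm{dist}_{r_s}(s,t)$, for all nodes $s$. 1. For every edge $(u,v)$ of $G$ and all nodes $s$, both $u$ and $v$ internally compute $r''_s(u,v)=r'_s(u,v)$. 2. For every pair of nodes $s,t$, initially $d^t_{r''_s}(s,t)=\infty$ (for $s\ne t$) and $d^t_{r''_t}(t,t)=0$, unless $t$ itself is a center; in this case $d^t_{r''_s}(s,t)=\Delta$ if $\mathrm{dist}_{r_s}(s,t)=0$ and $\Delta\lceil\mathrm{dist}_{r_s}(s,t)/\Delta\rceil$ otherwise. 3. For every node $s$ (in parallel), compute the shortest path tree from $s$ up to depth $n+h\Delta$ in terms of $r''_s$ by the following BFS: each node $t\neq s$ updates $d^t_{r''_s}(s,t)$ according to the messages $d^x_{r''_s}(s,x)$ received from neighbors $x$; if $d^t_{r''_s}(s,t)\le n+h\Delta$, then in round $d^t_{r''_s}(s,t)/\Delta$ (rounds counted from 0) node $t$ sends $d^t_{r''_s}(s,t)$ to all its neighbors in $G$, if it has not yet sent a message in this step. 4. Every node $t$ sets $d^t_{r_s}(s,t)=\lfloor d^t_{r''_s}(s,t)\rfloor$ for all nodes $s$, unless $t$ is a center, in which case $d^t_{r_s}(s,t)=\mathrm{dist}_{r_s}(s,t)$. Then for every node $s$, in parallel: (i) in round 0 every node $t$ sends $d^t_{r_s}(s,t)$ to all its neighbors; (ii) when $t$ receives $d^x_{r_s}(s,x)$ from a neighbor $x$, it uses it to decrease $d^t_{r_s}(s,t)$ (as an upper estimate of $\mathrm{dist}_{r_s}(s,t)$); (iii) if $d^t_{r_s}(s,t)$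 decreases and $d^t_{r_s}(s,t)\ge d^t_{r''_s}(s,t)-h\Delta$, then $t$ sends the new value to all its neighbors; (iv) repeat (ii) and (iii) for $h+1$ rounds. 5. Every node $t$ calculates $d^t_{w'}(s,t)=2\,\mathrm{dist}_w(s,t)+d^t_{r_s}(s,t)$ for all nodes $s$.
   Formalization: The running-time bound is stated for positive integers h ≤ n²; for larger h it fails, since Step 4 of Algorithm E alone lasts at least h+1 rounds (take n = 2 and h growing). *)

(* Defs.v *)
From mathcomp Require Import all_boot all_order all_algebra.
From mathcomp Require Import boolp classical_sets reals constructive_ereal.

Set Implicit Arguments.
Unset Strict Implicit.
Unset Printing Implicit Defensive.

Import Order.TTheory GRing.Theory Num.Theory.

(* The nodes are their own IDs, i.e. the elements of 'I_n. *)
Record network (n : nat) (e : rel 'I_n) : Prop := Network {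
  net_sym : symmetric e;
  net_irr : irreflexive e;
  net_conn : forall u v : 'I_n, connect e u v
}.

(* A path is given by its first node s and the sequence p of its other nodes,
   so that its number of edges is size p. *)
Definition st_path (n : nat) (e : rel 'I_n) (s t : 'I_n) (p : seq 'I_n) : bool :=
  [&& path e s p, last s p == t & uniq (s :: p)].

Fixpoint plen (n : nat) (f : 'I_n -> 'I_n -> nat) (s : 'I_n) (p : seq 'I_n) : nat :=
  if p is x :: p' then f s x + plen f x p' else 0.

Definition shortest (n : nat) (e : rel 'I_n) (f : 'I_n -> 'I_n -> nat)
    (s t : 'I_n) (p : seq 'I_n) : Prop :=
  st_path e s t p /\ forall q, st_path e s t q -> plen f s p <= plen f s q.

(* The default value 0 is irrelevant: networks are connected. *)
Definition dist (n : nat) (e : rel 'I_n) (f : 'I_n -> 'I_n -> nat) (s t : 'I_n) : nat :=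
  xget 0 [set d | exists2 p, shortest e f s t p & plen f s p = d]%classic.

Definition is_Pstar (n : nat) (e : rel 'I_n) (f : 'I_n -> 'I_n -> nat)
    (s t : 'I_n) (p : seq 'I_n) : Prop :=
  shortest e f s t p /\ forall q, shortest e f s t q -> size p <= size q.

(* The subpath P|C of P = (s, p), again as a pair (first node, other nodes). *)
Fixpoint from_last_center (n : nat) (C : {set 'I_n}) (s : 'I_n) (p : seq 'I_n) :
    'I_n * seq 'I_n :=
  if p is x :: p' then
    if has (mem C) p then from_last_center C x p' else (s, p)
  else (s, p).

Definition scaled_weight (n : nat) (w : 'I_n -> 'I_n -> nat) (b : 'I_n -> 'I_n -> bool)
    (u v : 'I_n) : nat :=
  2 * w u v + b u v.

(* On edges the subtraction is not truncated, by the triangle inequality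
   dist_w(s,v) <= dist_w(s,u) + w(u,v). *)
Definition reduced_weight (n : nat) (e : rel 'I_n)
    (w : 'I_n -> 'I_n -> nat) (b : 'I_n -> 'I_n -> bool) (s u v : 'I_n) : nat :=
  2 * dist e w s u + scaled_weight w b u v - 2 * dist e w s v.

(* Each node runs the same program on its own local input of type I.  Round i
   consists of the node sending at most one message over each incident edge,
   as a function of its input and its state, and then updating its state with
   the messages that arrived at the end of the round. *)
Record program (n : nat) (I S M : Type) := Program {
  rounds : nat;
  init : I -> S;
  send : I -> nat -> S -> 'I_n -> option M;
  recv : I -> nat -> S -> ('I_n -> option M) -> S
}.

Fixpoint state (n : nat) (I S M : Type) (P : program n I S M) (e : rel 'I_n)
    (inp : 'I_n -> I) (i : nat) (t : 'I_n) : S :=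
  if i is j.+1 then
    recv P (inp t) j (state P e inp j t)
      (fun x => if e x t then send P (inp x) j (state P e inp j x) t else None)
  else init P (inp t).

Definition final (n : nat) (I S M : Type) (P : program n I S M) (e : rel 'I_n)
    (inp : 'I_n -> I) (t : 'I_n) : S :=
  state P e inp (rounds P) t.

Definition message (n : nat) (I S M : Type) (P : program n I S M) (e : rel 'I_n)
    (inp : 'I_n -> I) (i : nat) (u v : 'I_n) : option M :=
  if e u v then send P (inp u) i (state P e inp i u) v else None.

(* P is a family of programs run in parallel, one for each source s. *)
Definition dilation (n : nat) (I S M : Type) (P : 'I_n -> program n I S M) : nat :=
  \max_(s < n) rounds (P s).

Definition congestion (n : nat) (I S M : Type) (P : 'I_n -> program n I S M)
    (e : rel 'I_n) (inp : 'I_n -> 'I_n -> I) : nat :=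
  \max_(uv : 'I_n * 'I_n)
    \sum_(s < n) \sum_(i < rounds (P s)) isSome (message (P s) e (inp s) i uv.1 uv.2).

(* Running time of a parallel family by the scheduling rule of the model:
   K is the constant hidden in O(dilation + congestion * log n). *)
Definition parallel_rounds (K n : nat) (I S M : Type) (P : 'I_n -> program n I S M)
    (e : rel 'I_n) (inp : 'I_n -> 'I_n -> I) : nat :=
  K * (dilation P + congestion P e inp * up_log 2 n).

(* All messages of the parallel execution, tagged with the source of the
   program they belong to, are taken from the list A. *)
Definition messages_in (n : nat) (I S : Type) (M : eqType) (P : 'I_n -> program n I S M)
    (e : rel 'I_n) (inp : 'I_n -> 'I_n -> I) (A : seq ('I_n * M)) : Prop :=
  forall s i u v m, i < rounds (P s) ->
    message (P s) e (inp s) i u v = Some m -> (s, m) \in A.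

(* Entries about non-neighbors (k_wout, k_win, k_red), and k_cdist at a node
   that is not a center, carry no information: see knowledge_of. *)
Record knowledge (n : nat) := Knowledge {
  k_id : 'I_n;
  k_nbr : {set 'I_n};
  k_centers : {set 'I_n};
  k_wout : 'I_n -> nat;          (* x |-> w'(t,x) *)
  k_win : 'I_n -> nat;           (* x |-> w'(x,t) *)
  k_distw : 'I_n -> nat;         (* s |-> dist_w(s,t) *)
  k_red : 'I_n -> 'I_n -> nat;   (* s x |-> r_s(t,x) *)
  k_cdist : 'I_n -> nat          (* s |-> d^t_{w'}(s,t), for a center t *)
}.

(* dc s c is the value d^c_{w'}(s,c) that the center c holds beforehand. *)
Definition knowledge_of (n : nat) (e : rel 'I_n) (w : 'I_n -> 'I_n -> nat)
    (b : 'I_n -> 'I_n -> bool) (C : {set 'I_n}) (dc : 'I_n -> 'I_n -> nat) (t : 'I_n) :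
    knowledge n :=
  {| k_id := t;
     k_nbr := [set x | e t x];
     k_centers := C;
     k_wout := fun x => if e t x then scaled_weight w b t x else 0;
     k_win := fun x => if e x t then scaled_weight w b x t else 0;
     k_distw := fun s => dist e w s t;
     k_red := fun s x => if e t x then reduced_weight e w b s t x else 0;
     k_cdist := fun s => if t \in C then dc s t else 0 |}.

Definition is_center (n : nat) (k : knowledge n) : bool := k_id k \in k_centers k.

(* r_s(x,t) for a neighbor x, from r_s(t,x) + r_s(x,t) = w'(t,x) + w'(x,t). *)
Definition k_red_in (n : nat) (k : knowledge n) (s x : 'I_n) : nat :=
  k_wout k x + k_win k x - k_red k s x.

(* dist_{r_s}(s,t) at a center t, from dist_{w'} = 2 dist_w + dist_{r_s}. *)
Definition k_cdist_red (n : nat) (k : knowledge n) (s : 'I_n) : nat :=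
  k_cdist k s - 2 * k_distw k s.

Local Open Scope ring_scope.
Local Open Scope ereal_scope.

Definition Delta (R : realType) (h : nat) : R := Num.sqrt (1 / h%:R)%R.

Definition round_up (R : realType) (h : nat) (r : nat) : R :=
  if r == 0%N then Delta R h
  else (Delta R h * (Num.ceil (r%:R / Delta R h))%:~R)%R.

Definition depth (R : realType) (n h : nat) : R := (n%:R + h%:R * Delta R h)%R.

(* Minimum of the current estimate d and of the estimates obtained from the
   received ones through the incoming edges, f x being the weight from x. *)
Definition relax (R : realType) (n : nat) (k : knowledge n) (f : 'I_n -> R)
    (inbox : 'I_n -> option (\bar R)) (d : \bar R) : \bar R :=
  Order.min d (\big[Order.min/+oo]_(x in k_nbr k)
                 (if inbox x is Some dx then dx + (f x)%:E else +oo)).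

(* A center starts with its rounded distance even when it is s itself. *)
Definition bfs_init (R : realType) (n h : nat) (s : 'I_n) (k : knowledge n) : \bar R :=
  if is_center k then (round_up R h (k_cdist_red k s))%:E
  else if k_id k == s then 0 else +oo.

Definition bfs_sends (R : realType) (n h : nat) (i : nat) (st : \bar R * bool) : bool :=
  [&& st.1 <= (depth R n h)%:E, st.1 == (i%:R * Delta R h)%:E & ~~ st.2].

(* Computation of d^t_{r''_s}(s,t); the state is this estimate, together with
   whether t has already sent a message. *)
Definition bfs (R : realType) (n h : nat) (s : 'I_n) :
    program n (knowledge n) (\bar R * bool) (\bar R) :=
  {| rounds := (Num.truncn (depth R n h / Delta R h)%R).+1;
     init := fun k => (bfs_init R h s k, false);
     send := fun k i st _ => if bfs_sends n h i st then Some st.1 else None;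
     recv := fun k i st inbox =>
       (if k_id k == s then st.1
        else relax k (fun x => round_up R h (k_red_in k s x)) inbox st.1,
        st.2 || bfs_sends n h i st) |}.

Definition refine_init (R : realType) (n : nat) (s : 'I_n) (inp : knowledge n * \bar R) :
    \bar R :=
  if is_center inp.1 then (k_cdist_red inp.1 s)%:R%:E
  else er_map (fun x : R => (Num.floor x)%:~R) inp.2.

(* Computation of d^t_{r_s}(s,t); the state is this estimate, together with
   whether t sends it in the coming round, and inp.2 is d^t_{r''_s}(s,t).
   Messages are sent in round 0 and in the h+1 rounds after it; those arriving
   at the ends of rounds 0, ..., h are used to decrease the estimates. *)
Definition refine (R : realType) (n h : nat) (s : 'I_n) :
    program n (knowledge n * \bar R) (\bar R * bool) (\bar R) :=
  {| rounds := h.+2;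
     init := fun inp => (refine_init s inp, true);
     send := fun inp i st _ => if st.2 then Some st.1 else None;
     recv := fun inp i st inbox =>
       if (i <= h)%N then
         let d := relax inp.1 (fun x => (k_red_in inp.1 s x)%:R) inbox st.1 in
         (d, (d < st.1) && (inp.2 - (h%:R * Delta R h)%:E <= d))
       else st |}.

Definition bfs_estimate (R : realType) (n h : nat) (e : rel 'I_n) (kn : 'I_n -> knowledge n)
    (s t : 'I_n) : \bar R :=
  (final (bfs R h s) e kn t).1.

Definition refine_input (R : realType) (n h : nat) (e : rel 'I_n)
    (kn : 'I_n -> knowledge n) (s t : 'I_n) : knowledge n * \bar R :=
  (kn t, bfs_estimate R h e kn s t).

Definition refine_estimate (R : realType) (n h : nat) (e : rel 'I_n)
    (kn : 'I_n -> knowledge n) (s t : 'I_n) : \bar R :=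
  (final (refine R h s) e (refine_input R h e kn s) t).1.

(* d^t_{w'}(s,t), kn t being the initial knowledge of t. *)
Definition algE_output (R : realType) (n h : nat) (e : rel 'I_n) (kn : 'I_n -> knowledge n)
    (s t : 'I_n) : \bar R :=
  (2 * k_distw (kn t) s)%:R%:E + refine_estimate R h e kn s t.

Definition algE_rounds (R : realType) (K n h : nat) (e : rel 'I_n)
    (kn : 'I_n -> knowledge n) : nat :=
  (parallel_rounds K (bfs R h) e (fun=> kn)
   + parallel_rounds K (refine R h) e (refine_input R h e kn))%N.

Definition algE_messages_in (R : realType) (n h : nat) (e : rel 'I_n)
    (kn : 'I_n -> knowledge n) (A : seq ('I_n * \bar R)) : Prop :=
  messages_in (bfs R h) e (fun=> kn) A
  /\ messages_in (refine R h) e (refine_input R h e kn) A.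

(* Main.v *)
Require Import Defs.
From mathcomp Require Import all_boot all_order all_algebra.
From mathcomp Require Import boolp classical_sets reals constructive_ereal.
From mathcomp Require Import ring lra zify.

(* Put D(t) = dist_{w'}(s,t) - 2 dist_w(s,t), which is dist_{r_s}(s,t); D(v) <= D(u) + r_s(u,v)
   on edges, so no estimate of Algorithm E is ever below D, and D < n since b is 0/1-valued.
   Let v_0, ..., v_l (l <= h) be the part of P* that starts at s or at its last center: D is
   additive along it.  Rounding costs at most Delta per edge, plus Delta at v_0, so the BFS
   estimate of v_j is at most D(v_j) + (j+1) Delta.  For j < l this is within the depth
   n + h Delta, so v_j does send in the BFS, and exceeds D(v_j) by at most h Delta, so v_j
   forwards the exact value D(v_j) in the second phase, by round j.
   A node sends at most once per source in the BFS.  After round 0 of the second phase, it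
   sends strictly decreasing integers lying within h Delta = sqrt h of its BFS estimate, hence
   at most sqrt h times per source. *)

Set Implicit Arguments.
Unset Strict Implicit.
Unset Printing Implicit Defensive.

Import Order.TTheory GRing.Theory Num.Theory.

(** * Walks, simple paths and distances in a network *)

Section Distances.
Variables (n : nat) (e : rel 'I_n).
Implicit Types (f : 'I_n -> 'I_n -> nat) (s t u v x : 'I_n) (p q : seq 'I_n).

Lemma plen_cat f s p q : plen f s (p ++ q) = plen f s p + plen f (last s p) q.
Proof. by elim: p s => //= x p IHp s; rewrite IHp addnA. Qed.

Lemma leq_plen f M s p : (forall u v, e u v -> f u v <= M) -> path e s p ->
  plen f s p <= size p * M.
Proof.
move=> fM; elim: p s => //= x p IHp s /andP[esx px].
by rewrite mulSn leq_add ?fM ?IHp.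
Qed.

Lemma size_st_path s t p : st_path e s t p -> size p < n.
Proof.
case/and3P=> _ _ Up; rewrite -[n in _ < n]card_ord -/(size (s :: p)).
by rewrite -(card_uniqP Up) max_card.
Qed.

(** Loop erasure: if the start reappears in the simple path obtained for the tail, only the part
    after that occurrence is kept. Weights are natural numbers, so the length does not grow. *)
Lemma walk_st_path f s p : path e s p ->
  exists2 q, st_path e s (last s p) q & plen f s q <= plen f s p.
Proof.
elim: p s => [|x p IHp] s /=; first by exists [::]; rewrite // /st_path /= eqxx.
case/andP=> esx /IHp[q /and3P[pq /eqP lq Uq] le_qp].
have [s_in|s_notin] := boolP (s \in x :: q); last first.
  exists (x :: q); last by rewrite /= leq_add2l.
  by rewrite /st_path /= esx pq lq eqxx s_notin -/(uniq (x :: q)).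
have: path e s (x :: q) by rewrite /= esx.
have: last s (x :: q) = last x p by [].
have: plen f s (x :: q) <= f s x + plen f x p by rewrite /= leq_add2l.
move: (x :: q) s_in Uq {pq lq le_qp} => q' s_in; case/path.splitP: s_in => q1 q2.
rewrite cat_uniq rcons_uniq => /and3P[_ s_notin Uq2].
rewrite plen_cat last_cat cat_path last_rcons => le_q lq /andP[_ pq2].
exists q2; last exact: leq_trans (leq_addl _ _) le_q.
rewrite /st_path pq2 lq eqxx /= Uq2 andbT.
by apply: contra s_notin => s_q2; apply/hasP; exists s; rewrite // mem_rcons mem_head.
Qed.

Hypothesis net : network e.

Lemma shortest_exists f s t : exists p, shortest e f s t p.
Proof.
have [p pp lp] := connectP (net_conn net s t).
have [q qst _] := walk_st_path f pp; rewrite -lp in qst.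
pose len d := `[< exists2 p, st_path e s t p & plen f s p = d >].
have len_q : exists d, len d by exists (plen f s q); apply/asboolP; exists q.
case: (ex_minnP len_q) => d /asboolP[r rst rd] d_min; exists r; split=> // r' r'st.
by rewrite rd; apply: d_min; apply/asboolP; exists r'.
Qed.

Lemma dist_shortest f s t p : shortest e f s t p -> dist e f s t = plen f s p.
Proof.
move=> short_p; rewrite /dist; case: xgetP => [_ -> [q short_q <-]|no_d].
  by apply/eqP; rewrite eqn_leq short_p.2 ?short_q.2 //; [case: short_p|case: short_q].
by case: (no_d (plen f s p)); exists p.
Qed.

Lemma dist_le_plen f s p : path e s p -> dist e f s (last s p) <= plen f s p.
Proof.
move=> /(walk_st_path f)[q qst]; apply: leq_trans.
by have [r short_r] := shortest_exists f s (last s p); rewrite (dist_shortest short_r) short_r.2.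
Qed.

Lemma dist_self f s : dist e f s s = 0.
Proof. by apply/eqP; rewrite -leqn0; apply: (@dist_le_plen f s [::]). Qed.

Lemma dist_walk f s u p : path e u p ->
  dist e f s (last u p) <= dist e f s u + plen f u p.
Proof.
have [q short_q] := shortest_exists f s u; case/and3P: (short_q.1) => pq /eqP lq _ pp.
rewrite (dist_shortest short_q) -{2}lq -plen_cat -{1}lq -last_cat dist_le_plen //.
by rewrite cat_path pq lq.
Qed.

Lemma dist_edge f s u v : e u v -> dist e f s v <= dist e f s u + f u v.
Proof. by move=> euv; have := @dist_walk f s u [:: v]; rewrite /= addn0 euv; apply. Qed.

(** The prefix, the edge and the rest each give an upper bound on a distance, and their lengths add
    up to the shortest length, so no bound can be strict. *)
Lemma dist_shortest_edge f s t p x q : shortest e f s t (p ++ x :: q) ->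
  dist e f s x = dist e f s (last s p) + f (last s p) x.
Proof.
move=> short; have := dist_shortest short; case: short => /and3P[+ /eqP lt _] _.
rewrite last_cat /= in lt; rewrite cat_path plen_cat /= => /and3P[pp ex pq] dt.
have := dist_walk f s pq; have := dist_edge f s ex; have := dist_le_plen f pp.
by rewrite lt dt; lia.
Qed.

Lemma dist_le_max f M s t : (forall u v, e u v -> f u v <= M) -> dist e f s t <= n * M.
Proof.
move=> fM; have [p short_p] := shortest_exists f s t; rewrite (dist_shortest short_p).
case/and3P: (short_p.1) => pp _ _; apply: leq_trans (leq_plen fM pp) _.
by rewrite leq_mul2r ltnW ?orbT // (size_st_path short_p.1).
Qed.

(** * Reduced weights and reduced distances *)

Section Reduced.
Variables (w : 'I_n -> 'I_n -> nat) (b : 'I_n -> 'I_n -> bool).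
Local Notation w' := (scaled_weight w b).
Local Notation r := (reduced_weight e w b).

Definition reduced_dist s t : nat := dist e w' s t - 2 * dist e w s t.

Lemma plen_scaled s p :
  2 * plen w s p <= plen w' s p <= 2 * plen w s p + size p.
Proof.
elim: p s => //= x p IHp s; have := IHp x; rewrite /scaled_weight; case: (b s x); lia.
Qed.

(** Since w' >= 2w on every edge, the subtraction in [reduced_dist] is not truncated. *)
Lemma reduced_distE s t : dist e w' s t = 2 * dist e w s t + reduced_dist s t.
Proof.
rewrite subnKC //; have [p short_p] := shortest_exists w' s t.
rewrite (dist_shortest short_p); case/and3P: (short_p.1) => pp /eqP <- _.
by have := dist_le_plen w pp; have := plen_scaled s p; lia.
Qed.

(** A simple w-shortest path has fewer than n edges, and b adds at most 1 on each of them. This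
    keeps every reduced distance below the BFS depth. *)
Lemma reduced_dist_lt s t : reduced_dist s t < n.
Proof.
have [p short_p] := shortest_exists w s t; have := size_st_path short_p.1.
have := reduced_distE s t; rewrite (dist_shortest short_p).
case/and3P: (short_p.1) => pp /eqP <- _.
by have := dist_le_plen w' pp; have := plen_scaled s p; lia.
Qed.

Lemma reduced_dist_self s : reduced_dist s s = 0.
Proof. by rewrite /reduced_dist !dist_self. Qed.

Lemma reduced_weightE s u v : e u v ->
  2 * dist e w s v + r s u v = 2 * dist e w s u + w' u v.
Proof. by move=> /(dist_edge w s); rewrite /reduced_weight /scaled_weight; lia. Qed.

Lemma reduced_dist_edge s u v : e u v -> reduced_dist s v <= reduced_dist s u + r s u v.
Proof.
move=> euv; have := dist_edge w' s euv; have := reduced_weightE s euv.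
by rewrite !reduced_distE; lia.
Qed.

Lemma reduced_dist_shortest_edge s t p x q : shortest e w' s t (p ++ x :: q) ->
  reduced_dist s x = reduced_dist s (last s p) + r s (last s p) x.
Proof.
move=> short; have := dist_shortest_edge short; rewrite !reduced_distE.
case: short => /and3P[]; rewrite cat_path /= => /and3P[_ ex _] _ _ _.
by have := reduced_weightE s ex; lia.
Qed.

(** Polynomially bounded weights w give polynomially bounded reduced weights, which limits the
    values occurring in messages. *)
Lemma reduced_weight_le M s u v : (forall x y, e x y -> w x y <= M) -> e u v ->
  r s u v <= 2 * (n.+1 * M) + 1.
Proof.
move=> wM euv; have := dist_le_max s u wM; have := wM _ _ euv; rewrite mulSn.
by rewrite /reduced_weight /scaled_weight; case: (b u v); lia.
Qed.

Variables (C : {set 'I_n}) (dc : 'I_n -> 'I_n -> nat).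
Local Notation kn := (knowledge_of e w b C dc).

(** In r_s(t,x) + r_s(x,t) the potentials 2 dist_w cancel, leaving two weights w' that t knows. *)
Lemma k_red_inE s t x : e x t -> k_red_in (kn t) s x = r s x t.
Proof.
move=> ext; have etx : e t x by rewrite (net_sym net).
rewrite /k_red_in /= ext etx; have := reduced_weightE s ext.
by have := reduced_weightE s etx; lia.
Qed.

Lemma k_cdist_redE s t : (forall c, c \in C -> dc s c = dist e w' s c) ->
  t \in C -> k_cdist_red (kn t) s = reduced_dist s t.
Proof. by move=> dcE tC; rewrite /k_cdist_red /= tC dcE. Qed.

End Reduced.
End Distances.

(** The prefix q is what precedes P|C. It ends where exact knowledge is available from the start: at
    a center, or at s itself. *)
Lemma from_last_center_suffix n (C : {set 'I_n}) (s : 'I_n) (p : seq 'I_n) :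
  exists2 q, p = q ++ (from_last_center C s p).2 &
    if has (mem C) p then last s q \in C else last s q == s.
Proof.
elim: p s => [|x p IHp] s; first by exists [::] => /=.
rewrite /=; case: ifP => has_C; last by exists [::] => /=.
have [q pE qC] := IHp x; exists (x :: q); first by rewrite /= -pE.
by move: has_C qC; case: (has _ p); rewrite ?orbF //= => xC /eqP->.
Qed.

(** * The rounding unit Delta = 1 / sqrt h and the rounded weights *)

Section Rounding.
Local Open Scope ring_scope.
Variables (R : realType) (h : nat).
Hypothesis h_gt0 : (0 < h)%N.
Local Notation Delta := (Delta R h).
Local Notation round_up := (round_up R h).

Lemma Delta_gt0 : 0 < Delta.
Proof. by rewrite sqrtr_gt0 divr_gt0 // ltr0n. Qed.

Lemma Delta_le1 : Delta <= 1.
Proof.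
by rewrite -[leRHS](@sqrtr1 R) ler_wsqrtr // ler_pdivrMr ?ltr0n // mul1r ler1n.
Qed.

Lemma mul_Delta_sqrt : Delta * Num.sqrt h%:R = 1.
Proof.
by rewrite -sqrtrM ?divr_ge0 ?ler0n // divfK ?sqrtr1 // pnatr_eq0 -lt0n.
Qed.

Lemma depth_ge0 n : 0 <= depth R n h.
Proof. by rewrite addr_ge0 // mulr_ge0 // ltW // Delta_gt0. Qed.

Lemma mul_h_Delta : h%:R * Delta = Num.sqrt h%:R.
Proof.
by rewrite -{1}[h%:R]sqr_sqrtr ?ler0n // expr2 -mulrA [_ * Delta]mulrC mul_Delta_sqrt mulr1.
Qed.

(** Because rounded weights are multiples of Delta, every finite BFS estimate designates an integer
    round in which to send it. *)
Lemma round_up_multiple r : exists2 k, (0 < k)%N & round_up r = k%:R * Delta.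
Proof.
rewrite /round_up; case: eqP => [_|/eqP r0]; first by exists 1%N; rewrite ?mul1r.
have x_gt0 : 0 < r%:R / Delta by rewrite divr_gt0 ?Delta_gt0 // ltr0n lt0n.
have := ceil_gt0 (r%:R / Delta); rewrite x_gt0; case: (Num.ceil _) => // k k_gt0.
by exists k; rewrite // mulrC.
Qed.

Lemma round_up_ge_Delta r : Delta <= round_up r.
Proof.
by have [k k0 ->] := round_up_multiple r; rewrite ler_peMl ?(ltW Delta_gt0) // ler1n.
Qed.

Lemma round_up_ge r : r%:R <= round_up r.
Proof.
rewrite /round_up; case: eqP => [->|_]; first exact: ltW Delta_gt0.
by rewrite mulrC -ler_pdivrMr ?Delta_gt0 // ceil_ge.
Qed.

Lemma round_up_le r : round_up r <= r%:R + Delta.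
Proof.
rewrite /round_up; case: eqP => [->|_]; first by rewrite add0r.
rewrite mulrC -ler_pdivlMr ?Delta_gt0 // mulrDl divff ?gt_eqF ?Delta_gt0 //.
by have /andP[] := ceil_itv (r%:R / Delta); rewrite intrB => ? _; lra.
Qed.

End Rounding.

(** * One relaxation step at a node *)

Section Relaxation.
Local Open Scope ereal_scope.
Variables (R : realType) (n : nat) (k : knowledge n).
Implicit Types (f : 'I_n -> R) (inbox : 'I_n -> option (\bar R)) (d : \bar R).

(** The minimum is attained, so an invariant need only be checked on the old estimate and on a
    single message. *)
Lemma relax_cases f inbox d d' : relax k f inbox d = d' ->
  d' = d \/ exists x dx, [/\ x \in k_nbr k, inbox x = Some dx & d' = dx + (f x)%:E].
Proof.
move=> <-; rewrite /relax; set m := \big[_/_]_(_ in _) _.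
suff [->|[x [dx [xk ix mE]]]] : m = +oo \/ exists x dx,
    [/\ x \in k_nbr k, inbox x = Some dx & m = dx + (f x)%:E].
- by left; rewrite min_l ?leey.
- by rewrite minEle; case: ifP => _; [left|right; exists x, dx].
rewrite {}/m; elim/big_ind: _ => [|a c Qa Qc|x xk]; first by left.
- by rewrite minEle; case: ifP.
- by case ix: (inbox x) => [dx|]; [right; exists x, dx|left].
Qed.

Lemma relax_le f inbox d : relax k f inbox d <= d.
Proof. by rewrite /relax ge_min lexx. Qed.

Lemma relax_le_message f inbox d x dx : x \in k_nbr k -> inbox x = Some dx ->
  relax k f inbox d <= dx + (f x)%:E.
Proof.
move=> xk ix; rewrite /relax ge_min; apply/orP; right.
by apply: le_trans (bigmin_le_cond _ _ xk) _; rewrite ix.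
Qed.

End Relaxation.

(** * Invariants of the BFS phase for a fixed source *)

Section Execution.
Local Open Scope ring_scope.
Local Open Scope ereal_scope.
Variables (R : realType) (n h : nat) (e : rel 'I_n).
Variables (w : 'I_n -> 'I_n -> nat) (b : 'I_n -> 'I_n -> bool).
Variables (C : {set 'I_n}) (dc : 'I_n -> 'I_n -> nat).
Hypothesis h_gt0 : (0 < h)%N.
Hypothesis net : network e.
Hypothesis dcE : forall s c : 'I_n, c \in C -> dc s c = dist e (scaled_weight w b) s c.
Variable s : 'I_n.
Local Notation kn := (knowledge_of e w b C dc).
Local Notation Delta := (Delta R h).
Local Notation round_up := (round_up R h).
Local Notation r := (reduced_weight e w b s).
Local Notation D := (reduced_dist e w b s).

Local Notation bstate := (state (bfs R h s) e kn).
Local Notation best i t := (bstate i t).1.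

(** A message delivered in round i has value i Delta, because a node sends only when its estimate
    matches the round number. *)
Lemma bfs_step i t : best i.+1 t = best i t \/
  exists x, [/\ t != s, e x t, best i x = (i%:R * Delta)%:E,
    (i%:R * Delta <= depth R n h)%R & best i.+1 t = (i%:R * Delta + round_up (r x t))%:E].
Proof.
rewrite /=; case: ifP => [_|/negbT ts]; first by left.
move dE: (relax _ _ _ _) => d; case: (relax_cases dE) => [->|[x [dx [_]]]]; first by left.
case: ifP => // ext; case: ifP => // /and3P[le_depth /eqP eE _] [<-] ->.
right; exists x; split=> //; first by move: le_depth; rewrite eE lee_fin.
by rewrite (k_red_inE net) // eE.
Qed.

Lemma bfs_le i j t : (i <= j)%N -> best j t <= best i t.
Proof.
elim: j => [|j IHj]; first by rewrite leqn0 => /eqP->.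
rewrite leq_eqVlt => /orP[/eqP->//|/IHj]; apply: le_trans.
by rewrite /=; case: ifP => _ //; apply: relax_le.
Qed.

(** A change in round j >= i yields j Delta plus a rounded weight, which is at least Delta. So late
    rounds cannot create small values. *)
Lemma bfs_frozen i j t : (i <= j)%N ->
  best j t = best i t \/ (i.+1%:R * Delta)%:E <= best j t.
Proof.
elim: j => [|j IHj]; first by rewrite leqn0 => /eqP->; left.
rewrite leq_eqVlt => /orP[/eqP->//|lt_ij]; first by left.
case: (bfs_step j t) => [->|[x [_ _ _ _ ->]]]; first exact: IHj.
right; rewrite lee_fin -natr1 mulrDl mul1r lerD ?round_up_ge_Delta //.
by rewrite ler_wpM2r ?ler_nat // ltW // Delta_gt0.
Qed.

Lemma bfs_multiple i t : best i t = +oo \/ exists k : nat, best i t = (k%:R * Delta)%:E.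
Proof.
elim: i => [|i IHi] /=.
  rewrite /bfs_init; case: ifP => _.
    by have [k _ ->] := round_up_multiple R h_gt0 (k_cdist_red (kn t) s); right; exists k.
  by case: ifP => _; [right; exists 0%N; rewrite mul0r|left].
case: (bfs_step i t) => [/= ->//|[x [_ _ _ _ /= ->]]].
have [k _ ->] := round_up_multiple R h_gt0 (r x t).
by right; exists (i + k)%N; rewrite natrD mulrDl.
Qed.

(** The earlier sending took place in some round j < i with estimate j Delta, and estimates never
    increase. Hence the flag cannot block a node whose estimate is exactly i Delta in round i. *)
Lemma bfs_sent i t : (bstate i t).2 -> best i t < (i%:R * Delta)%:E.
Proof.
elim: i => // i IHi sent; apply: le_lt_trans (bfs_le t (leqnSn i)) _.
have ltS : (i%:R * Delta)%:E < (i.+1%:R * Delta)%:E.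
  by rewrite lte_fin ltr_pM2r ?ltr_nat // Delta_gt0.
case/orP: sent => [/IHi/lt_trans|/and3P[_ /eqP->]]; exact.
Qed.

Local Notation dB t := (bfs_estimate R h e kn s t).

(* A value k Delta is final at the beginning of round k, and is sent in round k. *)
Lemma bfs_estimate_edge t x : e t x -> x != s -> dB t <= (depth R n h)%:E ->
  dB x <= dB t + (round_up (r t x))%:E.
Proof.
rewrite /bfs_estimate /final; set N := rounds _ => etx xs.
have [->|[k tE]] := bfs_multiple N t; first by rewrite leye_eq.
rewrite {1}tE lee_fin => le_depth.
(* Round k belongs to the run: the number of rounds is one more than the integer part of depth /
   Delta. *)
have lt_kN : (k < N)%N.
  rewrite ltnS truncn_ge_nat; last by rewrite divr_ge0 ?depth_ge0 ?(ltW (Delta_gt0 R h_gt0)).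
  by rewrite ler_pdivlMr ?Delta_gt0.
have kE : best k t = (k%:R * Delta)%:E.
  case: (bfs_frozen t (ltnW lt_kN)) => [<-//|]; rewrite tE lee_fin.
  by rewrite ler_pM2r ?Delta_gt0 // ler_nat ltnn.
have sends_k : bfs_sends n h k (bstate k t).
  rewrite /bfs_sends kE lee_fin le_depth eqxx /=.
  by apply/negP => /bfs_sent; rewrite kE ltxx.
apply: le_trans (bfs_le x lt_kN) _; rewrite tE /= (negPf xs).
rewrite -(k_red_inE net w b C dc s etx) -kE.
apply: (@relax_le_message R n (kn x) (fun y => round_up (k_red_in (kn x) s y)) _ (best k x) t).
  by rewrite inE (net_sym net).
by rewrite etx sends_k.
Qed.

Lemma bfs_ge i t : (D t)%:R%:E <= best i t.
Proof.
elim: i t => [|i IHi] t.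
  rewrite /= /bfs_init /is_center /=; case: ifP => [tC|_].
    by rewrite lee_fin (k_cdist_redE (dcE s) tC) round_up_ge.
  by case: eqP => [->|_]; rewrite ?leey // (reduced_dist_self net).
case: (bfs_step i t) => [->//|[x [_ ext xE _ ->]]].
rewrite lee_fin; apply: le_trans (_ : (D x)%:R + (r x t)%:R <= _)%R.
  by rewrite -natrD ler_nat (reduced_dist_edge net).
by rewrite lerD ?round_up_ge // -lee_fin -xE.
Qed.

(** A finite estimate is either initial, hence below n + Delta, or comes from a message of value at
    most the depth over an edge of reduced weight at most M. Rounding adds at most Delta <= 1. *)
Lemma bfs_bounded M i t : (forall u v, e u v -> (r u v <= M)%N) ->
  best i t = +oo \/ best i t <= (depth R n h + M%:R + 1)%:E.
Proof.
move=> rM; have D1 := Delta_le1 R h_gt0; have D0 := Delta_gt0 R h_gt0.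
have hD : (0 <= h%:R * Delta)%R by rewrite mulr_ge0 // ltW.
have M0 : (0 <= M%:R :> R)%R by [].
elim: i => [|i IHi].
  rewrite /= /bfs_init /is_center /=; case: ifP => [tC|_].
    right; rewrite lee_fin (k_cdist_redE (dcE s) tC) /depth.
    have := round_up_le R h_gt0 (D t); have := reduced_dist_lt net w b s t.
    by rewrite -(ler_nat R) -natr1; lra.
  by case: eqP => [_|_]; [right; rewrite lee_fin !addr_ge0|left].
case: (bfs_step i t) => [->//|[x [_ ext _ le_depth ->]]]; right; rewrite lee_fin.
have := round_up_le R h_gt0 (r x t); have := rM _ _ ext; rewrite -(ler_nat R); lra.
Qed.

Lemma bfs_message i u v m : message (bfs R h s) e kn i u v = Some m ->
  bfs_sends n h i (bstate i u) /\ m = (i%:R * Delta)%:E.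
Proof.
rewrite /message; case: ifP => //= _; case: ifP => // sends_i [<-].
by split=> //; case/and3P: sends_i => _ /eqP.
Qed.

(** By induction the count so far is at most the Boolean flag of u, which is false whenever u
    sends. *)
Lemma bfs_messages_le1 N u v : (\sum_(i < N) isSome (message (bfs R h s) e kn i u v) <= 1)%N.
Proof.
apply: (@leq_trans (bstate N u).2); last exact: leq_b1.
elim: N => [|N IHN]; first by rewrite big_ord0.
rewrite big_ord_recr /=; apply: leq_trans (leq_add IHN (leqnn _)) _.
case mE: (message _ _ _ _ _ _) => [m|] /=; last by case: (bstate N u).2.
by have [sends_N _] := bfs_message mE; rewrite sends_N orbT; case/and3P: sends_N => _ _ /negPf->.
Qed.

(** * Invariants of the second phase, on exact reduced weights *)

Local Notation rinput := (refine_input R h e kn s).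
Local Notation rstate := (state (refine R h s) e rinput).
Local Notation rest i t := (rstate i t).1.
Local Notation sends i t := (rstate i t).2.

Lemma refine_step i t : rest i.+1 t = rest i t \/
  exists x, [/\ e x t, sends i x & rest i.+1 t = rest i x + (r x t)%:R%:E].
Proof.
rewrite /=; case: ifP => [_|_]; last by left.
move dE: (relax _ _ _ _) => d; case: (relax_cases dE) => [->|[x [dx [_]]]]; first by left.
case: ifP => // ext; case: ifP => // sends_x [<-] ->; right; exists x; split=> //.
by rewrite (k_red_inE net).
Qed.

Lemma refine_le i j t : (i <= j)%N -> rest j t <= rest i t.
Proof.
elim: j => [|j IHj]; first by rewrite leqn0 => /eqP->.
rewrite leq_eqVlt => /orP[/eqP->//|/IHj]; apply: le_trans.
by rewrite /=; case: ifP => _ //=; apply: relax_le.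
Qed.

Lemma refine_edge i t x : (i <= h)%N -> e t x -> sends i t ->
  rest i.+1 x <= rest i t + (r t x)%:R%:E.
Proof.
move=> le_ih etx sends_t; rewrite /= le_ih -(k_red_inE net w b C dc s etx).
apply: (@relax_le_message R n (kn x) (fun y => (k_red_in (kn x) s y)%:R) _ (rest i x) t).
  by rewrite inE (net_sym net).
by rewrite etx sends_t.
Qed.

Lemma refine_sendsE i t : (i <= h)%N ->
  sends i.+1 t = (rest i.+1 t < rest i t) && (dB t - (h%:R * Delta)%:E <= rest i.+1 t).
Proof. by move=> le_ih; rewrite /= le_ih. Qed.

Lemma refine_init_noncenter t : t \notin C ->
  rest 0 t = er_map (fun x : R => (Num.floor x)%:~R) (dB t).
Proof. by move=> tC; rewrite /= /refine_init /is_center /= (negPf tC). Qed.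

Lemma refine_init_center t : t \in C -> rest 0 t = (D t)%:R%:E.
Proof.
by move=> tC; rewrite /= /refine_init /is_center /= tC (k_cdist_redE (dcE s) tC).
Qed.

(** Integrality makes each strict decrease at least 1, on which the counting of messages rests. *)
Lemma refine_nat i t : rest i t = +oo \/ exists k : nat, rest i t = k%:R%:E.
Proof.
elim: i t => [|i IHi] t; last first.
  case: (refine_step i t) => [->//|[x [_ _ ->]]].
  case: (IHi x) => [->|[k ->]]; [by left|right; exists (k + r x t)%N].
  by rewrite natrD.
have [tC|tC] := boolP (t \in C); first by right; exists (D t); rewrite refine_init_center.
rewrite refine_init_noncenter // /bfs_estimate /final.
case: (bfs_multiple (rounds (bfs R h s)) t) => [->|[k ->]]; [by left|right] => /=.
have : (0 <= k%:R * Delta)%R by rewrite mulr_ge0 // ltW // Delta_gt0.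
by rewrite -floor_ge0; case: (Num.floor _) => // m _; exists m.
Qed.

(** The floor taken at the start is harmless since [D t] is an integer below the BFS estimate. *)
Lemma refine_ge i t : (D t)%:R%:E <= rest i t.
Proof.
elim: i t => [|i IHi] t; last first.
  case: (refine_step i t) => [->//|[x [ext _ ->]]].
  apply: le_trans (leeD2r _ (IHi x)).
  by rewrite -EFinD -natrD lee_fin ler_nat (reduced_dist_edge net).
have [tC|tC] := boolP (t \in C); first by rewrite refine_init_center.
rewrite refine_init_noncenter //; have := bfs_ge (rounds (bfs R h s)) t.
rewrite -[(bstate _ t).1]/(dB t); case: (dB t) => //= x; rewrite !lee_fin => Dx.
by rewrite -[(D t)%:R]/((D t)%:Z%:~R) ler_int floor_ge_int.
Qed.

Lemma refine_init_le t : rest 0 t <= dB t.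
Proof.
have [tC|tC] := boolP (t \in C); first by rewrite refine_init_center // bfs_ge.
rewrite refine_init_noncenter //; case: (dB t) => //= x.
by rewrite lee_fin floor_le.
Qed.

(* Every value sent after round 0 is an integer in [d'' - h Delta, d''), where d''
   is the estimate of the first phase, and these values decrease strictly. *)
Lemma refine_sends_bound i t : (i <= h.+1)%N ->
  let m := (\sum_(j < i) sends j.+1 t)%N in
  (m%:R <= h%:R * Delta :> R)%R /\ m%:R%:E + rest i t <= dB t.
Proof.
elim: i => [|i IHi] le_ih /=.
  rewrite big_ord0; split; first by rewrite mulr_ge0 // ltW // Delta_gt0.
  by rewrite add0e refine_init_le.
rewrite big_ord_recr /=; have [] := IHi (ltnW le_ih); set m := (\sum_(j < i) _)%N.
rewrite -/(rstate i.+1 t) refine_sendsE //; move=> le_m le_dB.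
case: andP => [[lt_rest ge_dB]|_]; last first.
  by rewrite addn0; split=> //; apply: le_trans le_dB; rewrite leeD2l // (refine_le t (leqnSn i)).
move: le_dB lt_rest ge_dB; case: (refine_nat i.+1 t) => [->|[k ->]].
  by rewrite ltNge leey.
case: (refine_nat i t) => [->|[k' ->]].
  by case: (dB t).
case: (dB t) => //= d.
rewrite -!EFinD !lee_fin lte_fin ltr_nat => le_d lt_k le_k.
have : (k.+1%:R <= k'%:R :> R)%R by rewrite ler_nat.
rewrite -natr1 natrD => ?; split; lra.
Qed.

Lemma refine_message M i t : (forall u v, e u v -> (r u v <= M)%N) ->
  (i <= h.+1)%N -> sends i t ->
  rest i t = +oo \/ exists k : nat, rest i t = k%:R%:E /\ (k%:R <= depth R n h + M%:R + 1)%R.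
Proof.
move=> rM le_ih sends_t; case: (refine_nat i t) => [->|[k kE]]; first by left.
right; exists k; split=> //; have [_] := refine_sends_bound t le_ih.
move: (\sum_(_ < _) _)%N => m; rewrite kE.
have := bfs_bounded (rounds (bfs R h s)) t rM; rewrite -[(bstate _ t).1]/(dB t).
case dE: (dB t) => [d||].
- case=> // le_d le_d'; move: le_d le_d'; rewrite -EFinD !lee_fin => le_d le_d'.
  by have : (0 <= m%:R :> R)%R by []; lra.
(* If the BFS estimate is infinite, so is the threshold of rule (iii), and only round 0 can send a
   finite value. That value belongs to a center, so it is below n. *)
- move=> _ _; case: i le_ih kE sends_t => [|i] le_ih kE; last first.
    by rewrite refine_sendsE // kE dE andbF.
  have [tC|tC] := boolP (t \in C); last by rewrite refine_init_noncenter // dE in kE.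
  move: kE; rewrite refine_init_center // => -[<-] _.
  have := depth_ge0 R h_gt0 0; have := reduced_dist_lt net w b s t.
  by rewrite -(ler_nat R) -natr1 /depth; have : (0 <= M%:R :> R)%R by []; lra.
- by rewrite -EFinD leeNy_eq.
Qed.

Lemma refine_message_sends i u v m : message (refine R h s) e rinput i u v = Some m ->
  sends i u /\ m = rest i u.
Proof. by rewrite /message; case: ifP => //= _; case: ifP => // sends_i [<-]. Qed.

(** The summand 1 pays for the unconditional message of round 0. *)
Lemma refine_messages_le u v :
  ((\sum_(i < h.+2) isSome (message (refine R h s) e rinput i u v))%:R <= h%:R * Delta + 1 :> R)%R.
Proof.
apply: le_trans (_ : (\sum_(i < h.+2) sends i u)%:R <= _)%R.
  rewrite ler_nat; apply: leq_sum => i _.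
  by case mE: (message _ _ _ _ _ _) => [m|] //; have [->] := refine_message_sends mE.
rewrite big_ord_recl natrD addrC lerD ?lern1 ?leq_b1 //.
by have [] := refine_sends_bound u (leqnn h.+1).
Qed.

(** In the first round where the estimate is exact, either it has just strictly decreased and passes
    the filter by the bound on [dB t], or it is round 0, when everybody sends. *)
Lemma refine_first_exact j t : (j <= h.+1)%N -> rest j t = (D t)%:R%:E ->
  dB t <= (D t)%:R%:E + (h%:R * Delta)%:E ->
  exists2 i, (i <= j)%N & rest i t = (D t)%:R%:E /\ sends i t.
Proof.
move=> + + dBt; elim: j => [|j IHj] le_jh jE; first by exists 0%N.
have [jE'|neq] := eqVneq (rest j t) (D t)%:R%:E.
  by have [i le_ij] := IHj (ltnW le_jh) jE'; exists i; rewrite // ltnW.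
exists j.+1 => //; split=> //; rewrite refine_sendsE // jE leeBlDr // dBt andbT.
by rewrite lt_neqAle eq_sym neq refine_ge.
Qed.

(** * Exactness along a short shortest path from the source or a center *)

Section Path.
Variables (t : 'I_n) (p q : seq 'I_n).
Hypothesis short : shortest e (scaled_weight w b) s t (p ++ q).
Hypothesis start : last s p = s \/ last s p \in C.
Hypothesis size_q : (size q <= h)%N.

Lemma path_step q1 x q2 : q = rcons q1 x ++ q2 ->
  let u := last s (p ++ q1) in [/\ e u x, x != s & D x = (D u + r u x)%N].
Proof.
move=> qE /=; move: short; rewrite qE cat_rcons catA => short'; split.
- by case: short' => /and3P[]; rewrite cat_path /= => /and3P[].
- case: short' => /and3P[_ _ /=/andP[+ _]] _; rewrite mem_cat inE !negb_or eq_sym.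
  by case/and3P.
- exact: reduced_dist_shortest_edge short'.
Qed.

(** There is one Delta per edge of q1, and one more for the rounded initial value at a center. *)
Lemma bfs_path q1 q2 : q = q1 ++ q2 -> let v := last s (p ++ q1) in
  dB v <= ((D v)%:R + (size q1).+1%:R * Delta)%:E.
Proof.
elim/last_ind: q1 q2 => [|q1 x IHq] q2 qE /=.
  rewrite cats0 mul1r; apply: le_trans (bfs_le _ (leq0n _)) _.
  rewrite /= /bfs_init /is_center /=; case: ifP => [vC|/negbT vC].
    by rewrite lee_fin (k_cdist_redE (dcE s) vC) round_up_le.
  case: start vC => [->|-> //] _; rewrite eqxx lee_fin addr_ge0 //.
  exact: ltW (Delta_gt0 R h_gt0).
have [eux xs DE] := path_step qE.
have := IHq (x :: q2); rewrite -cat_rcons => /(_ qE) /= le_u.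
have le_size : (size q1 < size q)%N by rewrite qE size_cat size_rcons ltnS leq_addr.
(* The predecessor is not the last node, so at most h units of Delta have accumulated on top of a
   reduced distance below n. *)
have le_depth : dB (last s (p ++ q1)) <= (depth R n h)%:E.
  apply: le_trans le_u _; rewrite lee_fin lerD //.
    by rewrite ler_nat ltnW // (reduced_dist_lt net).
  by rewrite ler_pM2r ?Delta_gt0 // ler_nat (leq_trans le_size).
rewrite -rcons_cat last_rcons size_rcons.
apply: le_trans (bfs_estimate_edge eux xs le_depth) _.
apply: le_trans (leeD2r _ le_u) _; rewrite -EFinD lee_fin DE natrD.
have := round_up_le R h_gt0 (r (last s (p ++ q1)) x).
by rewrite -[(size q1).+2%:R]natr1 mulrDl mul1r; lra.
Qed.

(** Forwarding is claimed only after fewer than h edges: there the BFS error, at most [(size q1).+1]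
    times Delta, fits in the slack h Delta of the filter. A node after h edges ends q and need not
    forward. *)
Lemma refine_path q1 q2 : q = q1 ++ q2 -> let v := last s (p ++ q1) in
  exists2 i, (i <= size q1)%N & rest i v = (D v)%:R%:E /\ ((size q1 < h)%N -> sends i v).
Proof.
elim/last_ind: q1 q2 => [|q1 x IHq] q2 qE /=.
  exists 0%N => //; split=> //; rewrite cats0.
  have [vC|vC] := boolP (last s p \in C); first by rewrite refine_init_center.
  rewrite refine_init_noncenter //; case: start vC => [->|-> //] sC.
  (* A source that is not a center starts at 0, which is already its reduced distance. *)
  suff -> : dB s = 0 by rewrite /= floor0 (reduced_dist_self net).
  apply/eqP; rewrite eq_le; apply/andP; split.
    apply: le_trans (bfs_le _ (leq0n _)) _.
    by rewrite /= /bfs_init /is_center /= (negPf sC) eqxx.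
  by have := bfs_ge (rounds (bfs R h s)) s; rewrite (reduced_dist_self net).
have [eux xs DE] := path_step qE.
have := IHq (x :: q2); rewrite -cat_rcons => /(_ qE) /= [i le_i [iE sends_i]].
have lt_size : (size q1 < h)%N.
  by apply: leq_trans size_q; rewrite qE size_cat size_rcons ltnS leq_addr.
have xE : rest i.+1 x = (D x)%:R%:E.
  apply/eqP; rewrite eq_le refine_ge andbT.
  apply: le_trans (refine_edge _ eux (sends_i lt_size)) _.
    exact: leq_trans le_i (ltnW lt_size).
  by rewrite iE -EFinD -natrD DE.
rewrite -rcons_cat last_rcons size_rcons.
have [lt_h|ge_h] := ltnP (size q1).+1 h; last by exists i.+1.
have [||j le_j [jE sends_j]] := refine_first_exact _ xE.
- exact: leq_trans le_i (ltnW (ltnW lt_h)).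
- have := bfs_path qE; rewrite -rcons_cat last_rcons size_rcons => /le_trans; apply.
  by rewrite -EFinD lee_fin lerD2l ler_pM2r ?Delta_gt0 // ler_nat.
- by exists j; [exact: leq_trans le_j _|].
Qed.

Lemma refine_estimate_exact : refine_estimate R h e kn s t = (D t)%:R%:E.
Proof.
have [|i le_i] := @refine_path q [::]; first by rewrite cats0.
have -> : last s (p ++ q) = t by case: short => /and3P[_ /eqP].
case=> iE _; apply/eqP; rewrite eq_le refine_ge andbT -iE.
by apply: (refine_le _ (leq_trans le_i (leq_trans size_q _))); apply: ltnW.
Qed.

End Path.
End Execution.

(** * Dilation, congestion and the number of rounds *)

Lemma dilation_le n I S M (P : 'I_n -> program n I S M) B :
  (forall s, rounds (P s) <= B) -> dilation P <= B.
Proof. by move=> PB; apply/bigmax_leqP => s _. Qed.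

Lemma congestion_le n I S M (P : 'I_n -> program n I S M) e inp B :
    (forall s u v, \sum_(i < rounds (P s)) isSome (message (P s) e (inp s) i u v) <= B) ->
  congestion P e inp <= n * B.
Proof.
move=> PB; apply/bigmax_leqP => -[u v] _; rewrite -[n in n * _]card_ord -sum_nat_const.
by apply: leq_sum => s _; apply: PB.
Qed.

Section Complexity.
Local Open Scope ring_scope.
Variables (R : realType) (n h : nat).
Hypothesis h_gt0 : (0 < h)%N.
Hypothesis h_le : (h <= n ^ 2)%N.
Local Notation X := (n%:R * Num.sqrt h%:R : R).

Lemma sqrt_h_ge1 : 1 <= Num.sqrt h%:R :> R.
Proof. by rewrite -[leLHS]sqrtr1 ler_wsqrtr // ler1n. Qed.

Lemma sqrt_h_le : Num.sqrt h%:R <= n%:R :> R.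
Proof.
by rewrite -[leRHS]ger0_norm // -sqrtr_sqr ler_wsqrtr // -natrX ler_nat.
Qed.

Lemma n_le_X : n%:R <= X.
Proof. by rewrite ler_peMr // sqrt_h_ge1. Qed.

(** The assumption h <= n^2 enters through sqrt h <= n: h = sqrt h * sqrt h <= n sqrt h. *)
Lemma h_le_X : h%:R <= X.
Proof. by rewrite -[leLHS]sqr_sqrtr // expr2 ler_wpM2r ?sqrtr_ge0 // sqrt_h_le. Qed.

Lemma one_le_X : 1 <= X.
Proof. by apply: le_trans h_le_X; rewrite ler1n. Qed.

(** The depth divided by Delta is n sqrt h + h; these two terms and the extra round are each at most
    X. *)
Lemma rounds_bfs_le (s : 'I_n) : (rounds (bfs R h s))%:R <= 3 * X.
Proof.
rewrite /= -natr1; have D0 := Delta_gt0 R h_gt0.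
have /andP[+ _] := truncn_itv (divr_ge0 (depth_ge0 R h_gt0 n) (ltW D0)).
have -> : depth R n h / Delta R h = X + h%:R.
  rewrite mulrDl mulfK ?(lt0r_neq0 D0) //; congr (_ * _ + _).
  by apply: (mulfI (lt0r_neq0 D0)); rewrite mul_Delta_sqrt // divff ?(lt0r_neq0 D0).
by have := h_le_X; have := one_le_X; lra.
Qed.

Lemma rounds_bfs_le_square (s : 'I_n) : (rounds (bfs R h s) <= 3 * n ^ 2)%N.
Proof.
rewrite -(ler_nat R); apply: le_trans (rounds_bfs_le s) _.
by rewrite natrM ler_wpM2l // natrX expr2 ler_wpM2l // sqrt_h_le.
Qed.

(** Each phase has dilation at most 3X, and the congestions are at most X and 2X. With L =
    [up_log 2 n] this gives K (6X + 3XL), which is within 6K X (L + 1). *)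
Lemma algE_rounds_le (K : nat) e w b (C : {set 'I_n}) dc : network e ->
    (forall s c : 'I_n, c \in C -> dc s c = dist e (scaled_weight w b) s c) ->
  (algE_rounds R K h e (knowledge_of e w b C dc))%:R
    <= (6 * K)%:R * X * ((up_log 2 n).+1 ^ 1)%:R.
Proof.
move=> net dcE; set kn := knowledge_of _ _ _ _ _; set L := up_log 2 n.
have L0 : 0 <= L%:R :> R by [].
have X1 := one_le_X; have nX := n_le_X; have hX := h_le_X.
have s0 : 0 <= Num.sqrt h%:R :> R by apply: sqrtr_ge0.
have dil1 : (dilation (bfs (n := n) R h))%:R <= 3 * X.
  rewrite /dilation; elim/big_ind: _ => [|x y|s _]; first by rewrite mulr_ge0 // ltW //; lra.
    by rewrite /maxn; case: ifP.
  exact: rounds_bfs_le.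
have dil2 : (dilation (refine (n := n) R h))%:R <= 3 * X.
  apply: le_trans (_ : h.+2%:R <= _); first by rewrite ler_nat; apply: dilation_le.
  by rewrite -addn2 natrD; lra.
have con1 : (congestion (bfs R h) e (fun=> kn))%:R <= X.
  apply: le_trans nX; rewrite ler_nat -[leqRHS]muln1; apply: congestion_le => s u v.
  exact: bfs_messages_le1.
(* [congestion_le] takes a natural bound, so the real bound sqrt h + 1 is truncated. *)
pose B := Num.truncn (Num.sqrt h%:R + 1 : R).
have con2 : (congestion (refine R h) e (refine_input R h e kn))%:R <= 2 * X.
  apply: le_trans (_ : (n * B)%:R <= _).
    rewrite ler_nat; apply: congestion_le => s u v.
    rewrite /B truncn_ge_nat ?addr_ge0 // -(mul_h_Delta R h_gt0).
    exact: refine_messages_le.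
  rewrite natrM; apply: le_trans (_ : n%:R * (Num.sqrt h%:R + 1) <= _).
    by rewrite ler_wpM2l // truncn_le addr_ge0.
  by rewrite mulrDr mulr1; lra.
have -> : (6 * K)%:R * X * (L.+1 ^ 1)%:R = K%:R * (6 * X * (L%:R + 1)) :> R.
  by rewrite expn1 natrM natr1; ring.
rewrite /algE_rounds /parallel_rounds -/L natrD !natrM -mulrDr ler_wpM2l // !natrD !natrM.
have := ler_wpM2r L0 con1; have := ler_wpM2r L0 con2; have := mulr_ge0 (le_trans ler01 X1) L0.
by rewrite !mulrA; lra.
Qed.

End Complexity.

(** * Messages of O(log n) bits, as elements of a list of polynomial size *)

Section MessageLists.
Local Open Scope ereal_scope.
Variables (R : realType) (n h : nat).

Definition bfs_message_list : seq ('I_n * \bar R) :=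
  [seq (s, (i%:R * Delta R h)%R%:E) | s <- enum 'I_n, i <- iota 0 (3 * n ^ 2)].

(** [+oo] is listed because in round 0 every node sends, even one that the BFS did not reach. *)
Definition refine_message_list B : seq ('I_n * \bar R) :=
  [seq (s, m) | s <- enum 'I_n, m <- +oo :: [seq k%:R%:E | k <- iota 0 B.+1]].

Lemma size_message_lists B :
  size (bfs_message_list ++ refine_message_list B) = (n * (3 * n ^ 2) + n * B.+2)%N.
Proof.
by rewrite size_cat !size_allpairs size_enum_ord size_iota /= size_map size_iota.
Qed.

Hypotheses (h_gt0 : (0 < h)%N) (h_le : (h <= n ^ 2)%N).

(** In the bound for the second phase, 2n covers the depth n + sqrt h, the middle summand is the
    bound of [reduced_weight_le], and the last 1 covers rounding. *)
Lemma algE_messages_le M e w b (C : {set 'I_n}) dc : network e ->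
    (forall u v, e u v -> (w u v <= M)%N) ->
    (forall s c, c \in C -> dc s c = dist e (scaled_weight w b) s c) ->
  algE_messages_in h e (knowledge_of e w b C dc)
    (bfs_message_list ++ refine_message_list (2 * n + (2 * (n.+1 * M) + 1) + 1)).
Proof.
move=> net wM dcE; split=> s i u v m lt_i mE; rewrite mem_cat.
  have [_ ->] := bfs_message mE; apply/orP; left.
  apply: allpairs_f; rewrite ?mem_enum // mem_iota add0n /=.
  exact: leq_trans lt_i (rounds_bfs_le_square R h_gt0 h_le s).
have [sends_i ->] := refine_message_sends mE; apply/orP; right.
apply: allpairs_f; rewrite ?mem_enum // inE.
have rM x y := @reduced_weight_le n e net w b M s x y wM.
have [->|[k [-> le_k]]] := refine_message h_gt0 net dcE rM lt_i sends_i; first by rewrite eqxx.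
apply/orP; right; apply: map_f; rewrite mem_iota add0n /= ltnS -(ler_nat R).
apply: le_trans le_k _; rewrite [in leRHS]natrD lerD2r [in leRHS]natrD lerD2r.
rewrite /depth mul_h_Delta // mul2n -addnn natrD lerD2l.
exact: sqrt_h_le.
Qed.

End MessageLists.

(** Every term is a multiple of some power bounded through n^(p+3), with coefficients adding up to
    4a + 9. As n > 1, the logarithm L is positive, so 4a + 9 <= 2^(L (4a + 9)), while n <= 2^L takes
    care of the power. *)
Lemma poly_le_expn_up_log a p n : 1 < n ->
  n * (3 * n ^ 2) + n * (2 * n + (2 * (n.+1 * (a * n ^ p)) + 1) + 1).+2
    <= 2 ^ ((4 * a + p + 12) * up_log 2 n).
Proof.
move=> n_gt1; have n_gt0 := ltnW n_gt1.
have nX k : k <= p + 3 -> n ^ k <= n ^ (p + 3) by move=> ?; rewrite leq_exp2l.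
have n3 := nX 3 (leq_addl _ _).
have n2 : n * n <= n ^ (p + 3) by apply: (nX 2); lia.
have n1 : n <= n ^ (p + 3) by apply: (nX 1); lia.
have np : n * n.+1 * n ^ p <= 2 * n ^ (p + 3).
  rewrite expnD [n ^ p * _]mulnC mulnA leq_mul2r; apply/orP; right.
  by rewrite !expnS expn0; nia.
have anp := leq_mul (leqnn (2 * a)) np.
apply: leq_trans (_ : (4 * a + 9) * n ^ (p + 3) <= _).
  have -> : n * (3 * n ^ 2) = 3 * n ^ 3 by rewrite mulnCA -expnS.
  by lia.
have nL : n <= 2 ^ up_log 2 n by apply: up_logP.
have L_gt0 : 0 < up_log 2 n by rewrite up_log_gt0.
have -> : (4 * a + p + 12) * up_log 2 n = up_log 2 n * (4 * a + 9 + (p + 3)) by lia.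
rewrite expnM [in leqRHS]expnD leq_mul ?leq_exp2r ?addn3 //.
apply: leq_trans (ltnW (ltn_expl _ (ltnSn 1))) _.
by rewrite leq_exp2r ?addn_gt0 ?orbT // -{1}[2]expn1 leq_exp2l.
Qed.

(** * Correctness of the output with respect to w' *)

Section Correctness.
Local Open Scope ereal_scope.
Variables (R : realType) (n h : nat) (e : rel 'I_n).
Variables (w : 'I_n -> 'I_n -> nat) (b : 'I_n -> 'I_n -> bool).
Variables (C : {set 'I_n}) (dc : 'I_n -> 'I_n -> nat).
Hypothesis h_gt0 : (0 < h)%N.
Hypothesis net : network e.
Hypothesis dcE : forall s c : 'I_n, c \in C -> dc s c = dist e (scaled_weight w b) s c.
Variables s t : 'I_n.
Local Notation kn := (knowledge_of e w b C dc).

Lemma algE_output_ge : (dist e (scaled_weight w b) s t)%:R%:E <= algE_output R h e kn s t.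
Proof.
by rewrite (reduced_distE net) natrD EFinD leeD2l // refine_ge.
Qed.

Lemma algE_output_exact P : is_Pstar e (scaled_weight w b) s t P ->
    (size P <= h)%N \/ (size (from_last_center C s P).2 <= h)%N ->
  algE_output R h e kn s t = (dist e (scaled_weight w b) s t)%:R%:E.
Proof.
case=> short _ small.
suff exact_t : refine_estimate R h e kn s t = (reduced_dist e w b s t)%:R%:E.
  by rewrite /algE_output exact_t (reduced_distE net) natrD EFinD.
(* A short P is used whole, with an empty prefix ending at s; otherwise the part P|C is used, after
   the prefix that precedes it. *)
case: small => size_P.
  by apply: (@refine_estimate_exact _ _ _ _ _ _ _ _ h_gt0 net dcE _ _ [::] P) => //; left.
have [q PE qC] := from_last_center_suffix C s P.
apply: (@refine_estimate_exact _ _ _ _ _ _ _ _ h_gt0 net dcE _ _ q _ _ _ size_P).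
  by rewrite -PE.
by case: ifP qC => _ => [|/eqP]; [right|left].
Qed.

End Correctness.

Theorem lemma4p8 (R : realType) :
  (forall (n h : nat) (e : rel 'I_n) (w : 'I_n -> 'I_n -> nat)
      (b : 'I_n -> 'I_n -> bool) (C : {set 'I_n}) (dc : 'I_n -> 'I_n -> nat),
    (0 < h)%N -> network e ->
    (forall s c : 'I_n, c \in C -> dc s c = dist e (scaled_weight w b) s c) ->
    forall s t : 'I_n,
      let d := algE_output R h e (knowledge_of e w b C dc) s t in
      let dst : \bar R := ((dist e (scaled_weight w b) s t)%:R)%:E in
      (dst <= d)%E
      /\ (forall P : seq 'I_n, is_Pstar e (scaled_weight w b) s t P ->
           (size P <= h)%N \/ (size (from_last_center C s P).2 <= h)%N ->
           d = dst))
  /\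
  (forall K a p : nat, exists c k beta : nat, forall n h : nat,
    (0 < h)%N -> (h <= n ^ 2)%N ->
    exists2 A : seq ('I_n * \bar R), (size A <= 2 ^ (beta * up_log 2 n))%N &
    forall (e : rel 'I_n) (w : 'I_n -> 'I_n -> nat)
      (b : 'I_n -> 'I_n -> bool) (C : {set 'I_n}) (dc : 'I_n -> 'I_n -> nat),
    network e ->
    (forall u v : 'I_n, e u v -> (w u v <= a * n ^ p)%N) ->
    (forall s c : 'I_n, c \in C -> dc s c = dist e (scaled_weight w b) s c) ->
    ((algE_rounds R K h e (knowledge_of e w b C dc))%:R
       <= c%:R * (n%:R * Num.sqrt h%:R) * ((up_log 2 n).+1 ^ k)%:R :> R)%R
    /\ algE_messages_in h e (knowledge_of e w b C dc) A).
Proof.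
split=> [n h e w b C dc h_gt0 net dcE s t d dst|K a p].
  split; first exact: algE_output_ge.
  by move=> P; apply: algE_output_exact.
exists (6 * K), 1, (4 * a + p + 12) => n h h_gt0 h_le.
have [n_gt1|n_le1] := ltnP 1 n.
  exists (bfs_message_list R n h ++
          refine_message_list R n (2 * n + (2 * (n.+1 * (a * n ^ p)) + 1) + 1)).
    by rewrite size_message_lists poly_le_expn_up_log.
  move=> e w b C dc net wM dcE; split; first exact: algE_rounds_le.
  exact: algE_messages_le.
(* For n = 1 the bound on the size of A is 2 ^ 0, but nothing is sent. *)
exists [::] => // e w b C dc net wM dcE; split; first exact: algE_rounds_le.
have no_edge u v : e u v = false.
  suff -> : u = v by apply: net_irr.
  by apply: val_inj; have := ltn_ord u; have := ltn_ord v; rewrite /=; lia.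
by split=> s i u v m _; rewrite /message no_edge.
Qed.
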